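(* Let $S=\mathbb{K}[x_1,\dots,x_n]$ be a polynomial ring over a field $\mathbb{K}$, let $I\subset S$ be a monomial ideal generated by pure powers of variables, and let $J\subset S$ be a weakly $I$-stable ideal. If $J$ is sequentially pure, then $J$ is variable decomposable.
   Context: $G(J)$ denotes the set of minimal monomial generators of a monomial ideal $J$, and $\mathfrak{m}=\langle x_1,\dots,x_n\rangle$. For a monomial $u$, $\operatorname{supp}(u)=\{i: x_i\mid u\}$, $\max(u)=\max(\operatorname{supp}(u))$ with $\max(1)=-\infty$, and for $u\neq1$, $u'=u/x_{\max(u)}$. The ideal $I$ is generated by monomials of the form $x_i^{a_i}$ (some of the variables, possibly none, occurring). A monomial ideal $J$ with $G(J)\cap I=\emptyset$ is weakly $I$-stable if for each monomial $u\in J\setminus I$ and each $j<\max(u')$ there exists $i\in\operatorname{supp}(u)$ with $i>j$ and $ux_j/x_i\in J+I$ (no condition is imposed for $u=1$). For a nonempty subset $F\subset[n]=\{1,\dots,n\}$ and a vector $\mathbf a\in\mathbb{N}^n$ with $\operatorname{supp}(\mathbf a)=\{i:\mathbf a(i)\ne0\}\subset F$, put $t=\max(F)$ and $$J_{F,\mathbf a}=\langle u/x^{\mathbf a}: u\in G(J)\text{ and }\deg_{x_j}(u)=\mathbf a(j)\text{ for all }j\le t\rangle.$$ $J$ is sequentially pure if for each such $F$ and $\mathbf a$, whenever $x_j\in G(J_{F,\mathbf a})$ for some $j$, then (1) $J_{F,\mathbf a}$ is linear, i.e. all its minimal monomial generators have degree one, and (2) either $J_{F,\mathbf a+\mathbf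 e_t}=\langle1\rangle$ or $J_{F,\mathbf a+k\mathbf e_t}=\langle0\rangle$ for all integers $k\ge1$, where $\mathbf e_t$ is the $t$-th standard basis vector. Variable decomposable monomial ideals are defined recursively on the number of variables: a monomial ideal $J\subset S=\mathbb{K}[x_1,\dots,x_n]$ is variable decomposable if either (a) $J=\langle 0\rangle$ or $J=\langle 1\rangle$, or (b) there is a variable $x_v$ (called a shedding variable) such that, with $r=\max\{\deg_{x_v}(u):u\in G(J)\}$, all the ideals $$J_i:=\langle u/x_v^i: u\in G(J)\text{ and }\deg_{x_v}(u)=i\rangle\subset\mathbb{K}[x_1,\dots,\widehat{x_v},\dots,x_n],\qquad i=0,1,\dots,r,$$ are variable decomposable, and $J_{i-1}\subset J_i\mathfrak{m}$ for each $i=1,2,\dots,r$ (here the $J_i$ are extended to ideals of $S$). *)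

(* Defs.v *)
From mathcomp Require Import all_boot all_order all_algebra.
From mathcomp Require Import mpoly.

Set Implicit Arguments.
Unset Strict Implicit.
Unset Printing Implicit Defensive.

Import GRing.Theory.
Local Open Scope ring_scope.

(* The variable x_{k+1} is 'X_k with k : 'I_n, and the monomial with exponent
   vector u : 'X_{1..n} is 'X_[u].  MathComp's idealr structure only covers
   proper ideals, whereas the unit ideal is essential here, so an ideal is a
   Prop-valued subset, and ideals are compared extensionally. *)

Definition subset_of (K : fieldType) (n : nat) : Type := {mpoly K[n]} -> Prop.

Definition sub_ideal (K : fieldType) (n : nat) (A B : subset_of K n) : Prop :=
  forall p, A p -> B p.

Definition eq_ideal (K : fieldType) (n : nat) (A B : subset_of K n) : Prop :=
  forall p, A p <-> B p.

Definition is_ideal (K : fieldType) (n : nat) (A : subset_of K n) : Prop :=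
  [/\ A 0,
      forall p q, A p -> A q -> A (p + q)
    & forall c p, A p -> A (c * p)].

Definition ideal_gen (K : fieldType) (n : nat) (A : subset_of K n) :
    subset_of K n :=
  fun p => forall Q : subset_of K n, is_ideal Q -> sub_ideal A Q -> Q p.

Definition ideal0 (K : fieldType) (n : nat) : subset_of K n := fun p => p = 0.

Definition ideal1 (K : fieldType) (n : nat) : subset_of K n := fun=> True.

Arguments ideal0 K n : clear implicits.
Arguments ideal1 K n : clear implicits.

Definition ideal_add (K : fieldType) (n : nat) (A B : subset_of K n) :
    subset_of K n :=
  fun p => exists a b, [/\ A a, B b & p = a + b].

Definition ideal_mul (K : fieldType) (n : nat) (A B : subset_of K n) :
    subset_of K n :=
  ideal_gen (fun p => exists a b, [/\ A a, B b & p = a * b]).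

Definition mon_ideal (K : fieldType) (n : nat) (M : 'X_{1..n} -> Prop) :
    subset_of K n :=
  ideal_gen (fun p => exists2 u, M u & p = 'X_[u]).

Arguments mon_ideal K {n} M.

Definition max_ideal (K : fieldType) (n : nat) : subset_of K n :=
  ideal_gen (fun p => exists k : 'I_n, p = 'X_k).

Arguments max_ideal K n : clear implicits.

Definition monomial_ideal (K : fieldType) (n : nat) (J : subset_of K n) : Prop :=
  exists M : 'X_{1..n} -> Prop, eq_ideal J (mon_ideal K M).

Definition mingens (K : fieldType) (n : nat) (J : subset_of K n)
    (u : 'X_{1..n}) : Prop :=
  J 'X_[u] /\ forall w : 'X_{1..n}, J 'X_[w] -> (w <= u)%MM -> w = u.

Definition mnm_supp (n : nat) (u : 'X_{1..n}) : {set 'I_n} :=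
  [set i | u i != 0%N].

(* None is the maximum of the empty set, i.e. -oo. *)
Definition max_set (n : nat) (F : {set 'I_n}) : option 'I_n :=
  [pick i in F | [forall j in F, (j <= i)%N]].

Definition max_mnm (n : nat) (u : 'X_{1..n}) : option 'I_n :=
  max_set (mnm_supp u).

Definition lt_max (n : nat) (j : 'I_n) (o : option 'I_n) : bool :=
  if o is Some t then (j < t)%N else false.

(* u' = u / x_max(u); the value at u = 1, where u' is undefined, is 1, so that
   lt_max j (drop_max 1) never holds. *)
Definition drop_max (n : nat) (u : 'X_{1..n}) : 'X_{1..n} :=
  if max_mnm u is Some t then (u - U_(t))%MM else u.

Definition pure_power_ideal (K : fieldType) (n : nat) (I : subset_of K n) :
    Prop :=
  exists (A : {set 'I_n}) (a : 'I_n -> nat),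
    (forall i, i \in A -> (0 < a i)%N) /\
    eq_ideal I (mon_ideal K (fun u => exists2 i, i \in A & u = (U_(i) *+ a i)%MM)).

Definition weakly_stable (K : fieldType) (n : nat) (I J : subset_of K n) : Prop :=
  [/\ monomial_ideal J,
      forall u, mingens J u -> ~ I 'X_[u]
    & forall u : 'X_{1..n}, J 'X_[u] -> ~ I 'X_[u] ->
      forall j : 'I_n, lt_max j (max_mnm (drop_max u)) ->
      exists i : 'I_n, [/\ i \in mnm_supp u, (j < i)%N
        & ideal_add J I 'X_[(u - U_(i) + U_(j))%MM]]].

(* J_{F,a} with t = max F; the truncated difference (u - a)%MM is the exact
   quotient u / x^a, because a is supported in F, hence on the indices <= t. *)
Definition section_ideal (K : fieldType) (n : nat) (J : subset_of K n)
    (t : 'I_n) (a : 'X_{1..n}) : subset_of K n :=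
  mon_ideal K (fun w => exists u : 'X_{1..n},
    [/\ mingens J u, forall j : 'I_n, (j <= t)%N -> u j = a j & w = (u - a)%MM]).

(* max_set F = Some t says that F is nonempty with maximum t. *)
Definition sequentially_pure (K : fieldType) (n : nat) (J : subset_of K n) :
    Prop :=
  forall (F : {set 'I_n}) (t : 'I_n) (a : 'X_{1..n}),
    max_set F = Some t -> mnm_supp a \subset F ->
    (exists j : 'I_n, mingens (section_ideal J t a) U_(j)%MM) ->
    (forall w, mingens (section_ideal J t a) w -> mdeg w = 1%N) /\
    (eq_ideal (section_ideal J t (a + U_(t))%MM) (ideal1 K n) \/
     forall k : nat, (1 <= k)%N ->
       eq_ideal (section_ideal J t (a + U_(t) *+ k)%MM) (ideal0 K n)).

(* The variables other than x_v are renumbered by lift v. *)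
Definition remove_var (n : nat) (v : 'I_n.+1) (u : 'X_{1..n.+1}) : 'X_{1..n} :=
  [multinom u (lift v k) | k < n].

Definition slice (K : fieldType) (n : nat) (v : 'I_n.+1) (i : nat)
    (J : subset_of K n.+1) : subset_of K n :=
  mon_ideal K (fun w => exists u : 'X_{1..n.+1},
    [/\ mingens J u, u v = i & w = remove_var v (u - U_(v) *+ i)%MM]).

Definition extend (K : fieldType) (n : nat) (v : 'I_n.+1) (A : subset_of K n) :
    subset_of K n.+1 :=
  ideal_gen (fun p => exists2 q, A q
    & p = q \mPo [tuple ('X_(lift v k) : {mpoly K[n.+1]}) | k < n]).

Definition max_degree (K : fieldType) (n : nat) (v : 'I_n) (J : subset_of K n)
    (r : nat) : Prop :=
  (exists2 u, mingens J u & u v = r) /\ (forall u, mingens J u -> (u v <= r)%N).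

Fixpoint variable_decomposable (K : fieldType) (n : nat) :
    subset_of K n -> Prop :=
  match n with
  | 0 => fun J => eq_ideal J (ideal0 K 0) \/ eq_ideal J (ideal1 K 0)
  | m.+1 => fun J =>
      (eq_ideal J (ideal0 K m.+1) \/ eq_ideal J (ideal1 K m.+1)) \/
      exists (v : 'I_m.+1) (r : nat),
        [/\ max_degree v J r,
            forall i : nat, (i <= r)%N -> variable_decomposable (slice v i J)
          & forall i : nat, (1 <= i <= r)%N ->
              sub_ideal (extend v (slice v i.-1 J))
                        (ideal_mul (extend v (slice v i J)) (max_ideal K m.+1))]
  end.

(* Main.v *)
Require Import Defs.
From Stdlib Require Import Classical.
From mathcomp Require Import all_boot all_order all_algebra.
From mathcomp Require Import mpoly.

Set Implicit Arguments.
Unset Strict Implicit.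
Unset Printing Implicit Defensive.

Import GRing.Theory.

(** Let [G] be the set of minimal generators of [J], and use the variables
    [x_1, ..., x_n] in this order as shedding variables.  Slicing successively
    along [x_1, ..., x_(s-1)] isolates the generators with prescribed exponents
    on these variables, so the whole recursion is governed by one property of
    [G], called [sheds] below: if [u, z] in [G] agree before [s] and
    [u s < z s], then some [v] in [G] agrees with [u] before [s], has
    [v s = u s + 1], and properly divides [u] on the variables after [s].
    This is the inclusion [J_(i-1) <= J_i m] for the slices along [x_s]
    ([sheds_extend]), and it passes to the slices along [x_1] ([sheds_slice]).
    It also bounds the exponents of [x_s] in [G], as every step lowers the
    degree after [s] ([sheds_jump]).

    Stability and purity give [sheds] by strong induction on [s]
    ([sheds_mingens]).  Consider the part of [u] in the variables after [s].
    It is not 1, since otherwise [u] would divide [z].  If it is a single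
    variable, sequential purity applies: the presence of [z] excludes that the
    higher sections all vanish, so the next one is the unit ideal and provides
    [v].  If it has degree at least two, weak stability gives [l > s] with
    [m = u x_s / x_l] in [J + I].  Here [m] is not in [I]: as [u] is not in [I],
    the pure power dividing [m] would be one of [x_s], and it would divide [z].
    So some [v] in [G] divides [m].  Its exponents before [s] might be smaller
    than those of [u], but the property [sheds] at earlier variables allows one
    to raise them one variable at a time without increasing later exponents
    ([sheds_align]).  Finally [v s = u s + 1], because otherwise [v] would
    properly divide [u]. *)

(** * Membership in monomial ideals *)

Section MonomialIdeals.

Variables (K : fieldType) (n : nat).
Implicit Types (A B J : subset_of K n) (M : 'X_{1..n} -> Prop).
Implicit Types (u v w m : 'X_{1..n}).

Lemma ideal_gen_ideal A : is_ideal (ideal_gen A).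
Proof.
split=> [Q [Q0 _ _] _ //|p q Ap Aq Q idQ AQ|c p Ap Q idQ AQ].
  by case: (idQ) => _ addQ _; apply: addQ; [apply: Ap|apply: Aq].
by case: (idQ) => _ _ mulQ; apply: mulQ; apply: Ap.
Qed.

Lemma mem_ideal_gen A p : A p -> ideal_gen A p.
Proof. by move=> Ap Q _; apply. Qed.

(** A polynomial belongs to a monomial ideal exactly when each of its monomials
    does, because the polynomials with that property form an ideal. *)
Lemma mon_idealP M (p : {mpoly K[n]}) :
  mon_ideal K M p <->
  (forall m, m \in msupp p -> exists2 u, M u & (u <= m)%MM).
Proof.
split=> [Mp|suppM].
  pose Q (q : {mpoly K[n]}) :=
    forall m, m \in msupp q -> exists2 u, M u & (u <= m)%MM.
  apply: (Mp Q); last first.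
    move=> _ [u Mu ->] m; rewrite msuppX inE => /eqP ->.
    by exists u; rewrite // lepm_refl.
  split=> [m|q1 q2 Qq1 Qq2 m /msuppD_le|c q Qq m /msuppM_le].
  - by rewrite msupp0.
  - by rewrite mem_cat => /orP [/Qq1|/Qq2].
  case/allpairsP => -[m1 m2] /= [_ m2q ->].
  have [u Mu leu] := Qq _ m2q.
  by exists u => //; apply: (lepm_trans leu); apply: lem_addl.
have [M0 MD MM] := ideal_gen_ideal (fun q => exists2 u, M u & q = 'X_[K, u]%R).
rewrite (mpolyE p) big_seq; apply: (big_ind (mon_ideal K M)) => //.
move=> m /suppM [u Mu leu].
rewrite -(submK leu) mpolyXD -mul_mpolyC mulrA.
by apply: MM; apply: mem_ideal_gen; exists u.
Qed.

Lemma mon_idealX M m :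
  mon_ideal K M 'X_[m]%R <-> exists2 u, M u & (u <= m)%MM.
Proof.
rewrite mon_idealP; split=> [|ex m']; first by apply; rewrite msuppX inE.
by rewrite msuppX inE => /eqP ->.
Qed.

Lemma mingens_dvd J m :
  J 'X_[m]%R -> exists2 u, mingens J u & (u <= m)%MM.
Proof.
have [d] := ubnP (mdeg m); elim: d m => // d IHd m /ltnSE ledm Jm.
have [minm|nminm] := classic (mingens J m); first by exists m; rewrite ?lepm_refl.
have [w [Jw lewm neq]] : exists w, [/\ J 'X_[w]%R, (w <= m)%MM & w <> m].
  apply: NNPP => noex; case: nminm; split=> // w Jw lewm.
  by apply: NNPP => neq; apply: noex; exists w.
have ltwm : mdeg w < mdeg m.
  rewrite -(submK lewm) mdegD -[X in X < _]add0n ltn_add2r lt0n mdeg_eq0.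
  by apply/eqP => mw0; apply: neq; rewrite -(submK lewm) mw0 add0m.
have [u Gu leu] := IHd w (leq_trans ltwm ledm) Jw.
by exists u => //; apply: lepm_trans lewm.
Qed.

Lemma mingens_mon_ideal M :
  (forall u v, M u -> M v -> (u <= v)%MM -> u = v) ->
  forall u, mingens (mon_ideal K M) u <-> M u.
Proof.
move=> antiM u; split=> [[/mon_idealX [w Mw lewu] minu]|Mu].
  have <- // : w = u.
  by apply: minu => //; apply/mon_idealX; exists w; rewrite // lepm_refl.
split=> [|w /mon_idealX [v Mv lev] lewu].
  by apply/mon_idealX; exists u; rewrite // lepm_refl.
have eqvu : v = u by apply: antiM => //; apply: lepm_trans lewu.
apply/mnmP => i; apply/eqP; rewrite eqn_leq (mnm_lepP lewu i) /=.
by apply: (mnm_lepP); rewrite -{1}eqvu.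
Qed.

Lemma mingens_anti J u v :
  mingens J u -> mingens J v -> (u <= v)%MM -> u = v.
Proof. by move=> [Ju _] [_ minv]; apply: minv. Qed.

Lemma monomial_ideal_addX A B m :
  monomial_ideal A -> monomial_ideal B -> ideal_add A B 'X_[m]%R ->
  A 'X_[m]%R \/ B 'X_[m]%R.
Proof.
move=> [MA AM] [MB BM] [a [b [/AM/mon_idealP suppa /BM/mon_idealP suppb ab]]].
have : m \in msupp (a + b)%R by rewrite -ab msuppX inE.
move/msuppD_le; rewrite mem_cat => /orP [/suppa|/suppb] exu; [left|right].
  by apply/AM/mon_idealX.
by apply/BM/mon_idealX.
Qed.

End MonomialIdeals.

Lemma monomial_ideal_mon_ideal (K : fieldType) n (M : 'X_{1..n} -> Prop) :
  monomial_ideal (mon_ideal K M).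
Proof. by exists M. Qed.

(** * The shedding property of a set of monomials *)

(** Quantifying over pairs [u, z] that agree before [s] treats all iterated
    slices along the first variables at once; [z] certifies that the exponent
    of [x_s] has not yet reached its maximum in the slice of [u]. *)
Definition sheds_at n (G : 'X_{1..n} -> Prop) (s : 'I_n) :=
  forall u z, G u -> G z -> (forall j : 'I_n, j < s -> u j = z j) -> u s < z s ->
  exists v, [/\ G v, forall j : 'I_n, j < s -> v j = u j, v s = (u s).+1,
    forall j : 'I_n, s < j -> v j <= u j & exists2 j : 'I_n, s < j & v j < u j].

Definition sheds n (G : 'X_{1..n} -> Prop) := forall s, sheds_at G s.

(** The steps lower the degree in the variables after [s] strictly, so the
    last inequality bounds the number [d] of steps. *)
Lemma sheds_jump n (G : 'X_{1..n} -> Prop) (s : 'I_n) u z d :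
  sheds_at G s -> G u -> G z -> (forall j : 'I_n, j < s -> u j = z j) ->
  u s + d <= z s ->
  exists v, [/\ G v, forall j : 'I_n, j < s -> v j = u j, v s = u s + d,
    forall j : 'I_n, s < j -> v j <= u j
    & d + \sum_(j < n | s < j) v j <= \sum_(j < n | s < j) u j].
Proof.
move=> shG Gu Gz uz; elim: d => [|d IHd]; first by exists u; rewrite addn0.
rewrite addnS => lt_z; have [v [Gv vu vs lev sumv]] := IHd (ltnW lt_z).
have [||w [Gw wv ws lew [k ltsk ltk]]] := shG v z Gv Gz; last 1 first.
- exists w; split=> // [j ltj|||].
  + by rewrite wv // vu.
  + by rewrite ws vs.
  + by move=> j ltj; apply: leq_trans (lew j ltj) (lev j ltj).
  apply: leq_trans sumv; rewrite addSn -addnS leq_add2l.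
  rewrite [X in X < _](bigD1 k) //= [X in _ < X](bigD1 k) //= -addSn.
  by apply: leq_add => //; apply: leq_sum => j /andP [ltj _]; apply: lew.
- by move=> j ltj; rewrite vu // uz.
- by rewrite vs.
Qed.

(** A generator dividing [m] can be corrected, one variable at a time from the
    left, until it agrees before [p] with a generator [u] having the exponents
    of [m] there: no correction increases an exponent to its right. *)
Lemma sheds_align n (G : 'X_{1..n} -> Prop) (u v m : 'X_{1..n}) p :
  (forall s : 'I_n, s < p -> sheds_at G s) -> G u -> G v -> (v <= m)%MM ->
  (forall j : 'I_n, j < p -> m j = u j) ->
  exists w, [/\ G w, (w <= m)%MM & forall j : 'I_n, j < p -> w j = u j].
Proof.
move=> shG Gu Gv lev mu; elim: p shG mu => [|p IHp] shG mu; first by exists v.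
have [||w [Gw lew wu]] := IHp.
- by move=> s lts; apply: shG; apply: ltnW.
- by move=> j ltj; apply: mu; apply: ltnW.
have [ltpn|lenp] := ltnP p n; last first.
  by exists w; split=> // j _; apply: wu; apply: leq_trans lenp.
pose s := Ordinal ltpn.
have lews : w s <= u s by rewrite -mu //; apply: (mnm_lepP lew).
have [|w' [Gw' w'w w's lew' _]] :=
  sheds_jump (d := u s - w s) (shG s (ltnSn p)) Gw Gu wu.
  by rewrite subnKC.
rewrite subnKC // in w's; exists w'; split=> //.
  apply/mnm_lepP => j; have [ltjp|ltpj|eqjp] := ltngtP j p.
  - by rewrite w'w // (mnm_lepP lew).
  - by apply: leq_trans (lew' j ltpj) (mnm_lepP lew j).
  have -> : j = s by apply: val_inj.
  by rewrite w's -mu.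
move=> j; rewrite ltnS leq_eqVlt => /orP [/eqP eqjp|ltjp].
  by have -> : j = s by apply: val_inj.
by rewrite w'w // wu.
Qed.

(** * The shedding property for stable and pure ideals *)

Lemma max_setP n (F : {set 'I_n}) (i : 'I_n) :
  i \in F -> exists t, [/\ max_set F = Some t, t \in F & forall j, j \in F -> j <= t].
Proof.
move=> Fi; rewrite /max_set; case: pickP => [t /andP [Ft /forall_inP leF]|none].
  by exists t.
have [t Ft leF] := @arg_maxnP _ i (mem F) (@nat_of_ord n) Fi.
have /= := none t; have -> : t \in F by [].
by move=> /negP []; apply/forall_inP.
Qed.

Lemma max_set_initial n (t : 'I_n) : max_set [set i : 'I_n | i <= t] = Some t.
Proof.
have [|s [-> ]] := @max_setP n [set i : 'I_n | i <= t] t; first by rewrite inE.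
rewrite inE => lest leF; congr Some; apply/val_inj/eqP.
by rewrite eqn_leq lest leF // inE.
Qed.

Lemma lt_max_mnm n (u : 'X_{1..n}) (j i : 'I_n) :
  j < i -> u i != 0 -> lt_max j (max_mnm u).
Proof.
move=> ltji ui0; rewrite /max_mnm.
have [|t [-> _ leF]] := @max_setP n (mnm_supp u) i; first by rewrite inE.
by apply: leq_trans (leF i _) => //; rewrite inE.
Qed.

(** The condition [j < max u'] fails exactly when the part of [u] in the
    variables after [j] is 1 or a single variable. *)
Lemma drop_max_cases n (u : 'X_{1..n}) (j : 'I_n) :
  [\/ forall i : 'I_n, j < i -> u i = 0,
      exists2 q : 'I_n, j < q & forall i : 'I_n, j < i -> u i = U_(q)%MM i
    | lt_max j (max_mnm (drop_max u))].
Proof.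
have [/existsP [i /andP [ltji ui0]]|none] :=
  boolP [exists i : 'I_n, (j < i) && (u i != 0)]; last first.
  constructor 1 => i ltji; apply/eqP; apply: contraNT none => ui0.
  by apply/existsP; exists i; rewrite ltji.
have [|t [maxt]] := @max_setP n (mnm_supp u) i; first by rewrite inE.
rewrite inE => ut0 leF.
have ltjt : j < t by apply: leq_trans ltji (leF i _); rewrite inE.
have -> : drop_max u = (u - U_(t))%MM by rewrite /drop_max /max_mnm maxt.
have [/existsP [k /andP [ltjk uk0]]|none] :=
  boolP [exists k : 'I_n, (j < k) && ((u - U_(t))%MM k != 0)].
  by constructor 3; apply: lt_max_mnm uk0.
constructor 2; exists t => // k ltjk; apply/eqP.
have : (u - U_(t))%MM k == 0.
  by apply: contraNT none => uk0; apply/existsP; exists k; rewrite ltjk.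
rewrite mnmBE mnm1E; case: (t =P k) => [<-|_]; last by rewrite subn0.
by rewrite subn_eq0 => leu1; rewrite eqn_leq leu1 lt0n.
Qed.

Section StablePure.

Variables (K : fieldType) (n : nat) (I J : subset_of K n).

Definition truncate_mnm (s : 'I_n) (u : 'X_{1..n}) : 'X_{1..n} :=
  [multinom if (j <= s)%N then u j else 0 | j < n].

Lemma pure_power_idealX :
  pure_power_ideal I ->
  exists (A : {set 'I_n}) (a : 'I_n -> nat),
    forall m, I 'X_[m]%R <-> exists2 i, i \in A & a i <= m i.
Proof.
move=> [A [a [_ IA]]]; exists A, a => m; rewrite (IA _) mon_idealX; split.
  move=> [_ [i Ai ->] /mnm_lepP /(_ i)].
  by rewrite mulmnE mnm1E eqxx mul1n => lei; exists i.
move=> [i Ai lei]; exists (U_(i) *+ a i)%MM; first by exists i.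
apply/mnm_lepP => j; rewrite mulmnE mnm1E.
by case: eqP => [<-|_]; rewrite ?mul1n ?mul0n.
Qed.

(** The section at the exponents of [u] up to [s] has the minimal generator
    [x_q] because of [u], so purity applies to it.  The section obtained by
    raising the exponent of [x_s] by [z s - u s] contains a monomial because of
    [z], so the next section is the unit ideal; it contains 1 because the
    prefix of [u] times [x_s] is a minimal generator of [J]. *)
Lemma sequentially_pure_shed (s q : 'I_n) (u z : 'X_{1..n}) :
  sequentially_pure J -> mingens J u -> mingens J z ->
  (forall j : 'I_n, j < s -> u j = z j) -> u s < z s ->
  s < q -> (forall i : 'I_n, s < i -> u i = U_(q)%MM i) ->
  exists v, [/\ mingens J v, forall j : 'I_n, j < s -> v j = u j,
    v s = (u s).+1 & forall j : 'I_n, s < j -> v j = 0].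
Proof.
move=> pureJ Gu Gz uz ltuz ltsq uq; pose a := truncate_mnm s u.
have aE j : a j = if j <= s then u j else 0 by rewrite mnmE.
have uaU : (u - a)%MM = U_(q)%MM.
  apply/mnmP => j; rewrite mnmBE aE; case: leqP => [lejs|/uq ->].
    by rewrite subnn mnm1E; case: eqP lejs => // <-; rewrite leqNgt ltsq.
  by rewrite subn0.
have [||_ [sec1|sec0]] := pureJ _ s a (max_set_initial s).
- by apply/subsetP => j; rewrite !inE aE; case: leqP.
- exists q; apply/mingens_mon_ideal.
    move=> _ _ [u1 [Gu1 u1a ->]] [u2 [Gu2 u2a ->]] leu.
    have -> // : u1 = u2.
    apply: mingens_anti Gu1 Gu2 _; apply/mnm_lepP => j.
    have := mnm_lepP leu j; rewrite !mnmBE aE.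
    by case: (leqP j s) => [lejs _|_]; [rewrite u1a ?u2a|rewrite !subn0].
  by exists u; split=> // j lejs; rewrite aE lejs.
- have /mon_idealX [_ [v [Gv va ->]] lev] :
    section_ideal J s (a + U_(s))%MM 'X_[0%MM]%R by apply/sec1.
  exists v; split=> // [j ltjs||j ltsj].
  + by rewrite va ?(ltnW ltjs) // mnmDE aE (ltnW ltjs) mnm1E -val_eqE gtn_eqF ?addn0.
  + by rewrite va // mnmDE aE leqnn mnm1E eqxx addn1.
  have := mnm_lepP lev j.
  by rewrite mnmBE mnmDE aE [j <= s]leqNgt ltsj mnm1E -val_eqE ltn_eqF // subn0 mnm0E leqn0 => /eqP.
have lt0 : 0 < z s - u s by rewrite subn_gt0.
pose b := (a + U_(s) *+ (z s - u s))%MM.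
have : section_ideal J s b 'X_[(z - b)%MM]%R.
  apply: mem_ideal_gen; exists (z - b)%MM => //; exists z; split=> // j lejs.
  rewrite mnmDE aE lejs mulmnE mnm1E; case: eqP => [<-|neq].
    by rewrite mul1n subnKC // ltnW.
  rewrite mul0n addn0 uz // ltn_neqAle lejs andbT.
  by apply/eqP => eqjs; apply: neq; apply: val_inj.
move/(sec0 _ lt0)=> X0; have := mem_head (z - b)%MM [::].
by rewrite -(msuppX K) X0 msupp0.
Qed.

Lemma sheds_mingens :
  pure_power_ideal I -> weakly_stable I J -> sequentially_pure J ->
  sheds (mingens J).
Proof.
move=> ppI [monJ GJI stabJ] pureJ s.
have monI : monomial_ideal I.
  case: (ppI) => A [a [_ IA]].
  by exists (fun u => exists2 i, i \in A & u = (U_(i) *+ a i)%MM).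
have [A [a IX]] := pure_power_idealX ppI.
have [k] := ubnP (nat_of_ord s); elim: k s => // k IHk s /ltnSE lesk.
move=> u z Gu Gz uz ltuz.
have [u0|[q ltsq uq]|ltmax] := drop_max_cases u s.
- suff equz : u = z by rewrite equz ltnn in ltuz.
  apply: mingens_anti Gu Gz _; apply/mnm_lepP => j.
  have [ltjs|ltsj|eqjs] := ltngtP j s; first by rewrite uz.
    by rewrite u0.
  by rewrite (ord_inj eqjs) ltnW.
- have [v [Gv vu vs v0]] := sequentially_pure_shed pureJ Gu Gz uz ltuz ltsq uq.
  exists v; split=> // [j ltsj|]; first by rewrite v0.
  by exists q; rewrite // v0 // uq // mnm1E eqxx.
have [l [+ ltsl JIm]] := stabJ u (proj1 Gu) (GJI u Gu) s ltmax.
rewrite inE => ul0; set m := (_ + _)%MM in JIm.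
have ms : m s = (u s).+1.
  by rewrite mnmDE mnmBE !mnm1E eqxx -val_eqE gtn_eqF // subn0 addn1.
have ml : m l = (u l).-1.
  by rewrite mnmDE mnmBE !mnm1E eqxx -val_eqE ltn_eqF // addn0 subn1.
have lem j : j != s -> m j <= u j.
  by rewrite mnmDE mnmBE !mnm1E eq_sym => /negPf ->; rewrite addn0 leq_subr.
have Jm : J 'X_[m]%R.
  have [//|/IX [i Ai leai]] := monomial_ideal_addX monJ monI JIm.
  have [eqis|neqis] := eqVneq i s.
    (* a power of [x_s] dividing [m] divides [z], as [m s = u s + 1 <= z s] *)
    case: (GJI z Gz); apply/IX; exists i => //; rewrite eqis in leai *.
    by apply: leq_trans leai _; rewrite ms.
  by case: (GJI u Gu); apply/IX; exists i => //; apply: leq_trans leai (lem i _).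
have [v0 Gv0 lev0] := mingens_dvd Jm.
have [||v [Gv lev vu]] := sheds_align (p := s) _ Gu Gv0 lev0.
- by move=> t ltts; apply: IHk; apply: leq_trans lesk.
- move=> j ltjs; rewrite mnmDE mnmBE !mnm1E -!val_eqE !gtn_eqF ?subn0 ?addn0 //.
  exact: ltn_trans ltsl.
have levm j : v j <= m j by apply: (mnm_lepP lev).
have ltvl : v l < u l.
  by apply: leq_ltn_trans (levm l) _; rewrite ml ltn_predL lt0n.
exists v; split=> // [|j ltsj|]; last by exists l.
  apply/eqP; rewrite eqn_leq -{1}ms levm /= ltnNge; apply/negP => levs.
  suff equv : v = u by rewrite equv ltnn in ltvl.
  apply: mingens_anti Gv Gu _; apply/mnm_lepP => j.
  have [-> //|neqjs] := eqVneq j s.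
  exact: leq_trans (levm j) (lem j neqjs).
by apply: leq_trans (levm j) (lem j _); rewrite -val_eqE gtn_eqF.
Qed.

End StablePure.

(** * Slicing along the first variable *)

Lemma remove_varE n (v : 'I_n.+1) (u : 'X_{1..n.+1}) i k :
  remove_var v (u - U_(v) *+ i)%MM k = u (lift v k).
Proof. by rewrite mnmE mnmBE mulmnE mnm1E (negPf (neq_lift _ _)) subn0. Qed.

(** Generators with the same exponent of [x_v] are incomparable after that
    exponent is removed, so slicing produces no redundant generators. *)
Lemma mingens_slice (K : fieldType) n (v : 'I_n.+1) i (J : subset_of K n.+1) w :
  mingens (slice v i J) w <->
  exists u, [/\ mingens J u, u v = i & w = remove_var v (u - U_(v) *+ i)%MM].
Proof.
apply: mingens_mon_ideal => _ _ [u1 [Gu1 u1v ->]] [u2 [Gu2 u2v ->]] leu.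
have -> // : u1 = u2; apply: mingens_anti Gu1 Gu2 _; apply/mnm_lepP => j.
have [k ->|->] := unliftP v j; last by rewrite u1v u2v.
by rewrite -!(remove_varE v _ i); apply: (mnm_lepP leu).
Qed.

Lemma sheds_slice (K : fieldType) n i (J : subset_of K n.+1) :
  sheds (mingens J) -> sheds (mingens (slice ord0 i J)).
Proof.
move=> shJ s u z /mingens_slice [u1 [Gu1 u10 ->]] /mingens_slice [z1 [Gz1 z10 ->]].
move=> uz; rewrite !remove_varE => ltuz.
have [||v [Gv vu vs lev [q ltq ltvq]]] := shJ (lift ord0 s) u1 z1 Gu1 Gz1.
- move=> j; have [k ->|->] := unliftP ord0 j; last by rewrite u10 z10.
  by rewrite !lift0 ltnS => /uz; rewrite !remove_varE.
- by [].
exists (remove_var ord0 (v - U_(ord0) *+ i)%MM); split.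
- by apply/mingens_slice; exists v; split=> //; rewrite vu.
- by move=> j ltjs; rewrite !remove_varE vu // !lift0 ltnS.
- by rewrite !remove_varE.
- by move=> j ltsj; rewrite !remove_varE lev // !lift0 ltnS.
have [k eqq|eqq] := unliftP ord0 q; last by rewrite eqq in ltq.
by rewrite eqq !lift0 ltnS in ltq *; exists k; rewrite // !remove_varE -eqq.
Qed.

(** Substituting the renumbered variables is a ring morphism, so it suffices to
    factor a generator of one slice as a generator of the next slice times a
    variable times a further monomial, all in the smaller ring. *)
Lemma sheds_extend (K : fieldType) n i r (J : subset_of K n.+1) :
  sheds (mingens J) -> max_degree ord0 J r -> 1 <= i <= r ->
  sub_ideal (extend ord0 (slice ord0 i.-1 J))
            (ideal_mul (extend ord0 (slice ord0 i J)) (max_ideal K n.+1)).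
Proof.
move=> shJ [[z Gz zr] _]; case: i => // i /= ltir; set Q := ideal_mul _ _.
pose ext (q : {mpoly K[n]}) : {mpoly K[n.+1]} :=
  (q \mPo [tuple ('X_(lift ord0 k))%R | k < n])%R.
have [Q0 QD QM] : is_ideal Q by apply: ideal_gen_ideal.
move=> p; apply=> // _ [q sq ->]; rewrite -/(ext q).
apply: (sq (fun q => Q (ext q))).
  split=> [|p1 p2 Qp1 Qp2|c p1 Qp1]; rewrite /ext.
  - by rewrite rmorph0.
  - by rewrite rmorphD; apply: QD.
  - by rewrite rmorphM; apply: QM.
move=> _ [_ [u [Gu u0 ->]] ->].
have [||v [Gv _ v0 lev [j lt0j ltvj]]] := shJ ord0 u z Gu Gz.
- by [].
- by rewrite u0 zr.
have [k eqj|eqj] := unliftP ord0 j; last by rewrite eqj in lt0j.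
rewrite {}eqj in ltvj {lt0j}.
set wu := remove_var _ _; pose wv := remove_var ord0 (v - U_(ord0) *+ i.+1)%MM.
have lew : (wv + U_(k) <= wu)%MM.
  apply/mnm_lepP => l; rewrite mnmDE !remove_varE mnm1E.
  by case: eqP => [<-|_]; rewrite ?addn1 ?addn0 ?lev.
have -> : ext 'X_[wu]%R =
    (ext 'X_[(wu - (wv + U_(k)))%MM] * (ext 'X_[wv] * 'X_(lift ord0 k)))%R.
  rewrite -{1}(submK lew) !mpolyXD /ext !rmorphM /=; congr (_ * (_ * _))%R.
  by rewrite comp_mpolyXU -tnth_nth tnth_mktuple.
apply: QM; apply: mem_ideal_gen.
exists (ext 'X_[wv]%R), ('X_(lift ord0 k))%R; split=> //.
  apply: mem_ideal_gen; exists 'X_[wv]%R => //.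
  by apply: mem_ideal_gen; exists wv => //; exists v; split; rewrite // v0 u0.
by apply: mem_ideal_gen; exists (lift ord0 k).
Qed.

Lemma bounded_nat_max (P : nat -> Prop) b k :
  P k -> (forall i, P i -> i <= b) -> exists2 r, P r & forall i, P i -> i <= r.
Proof.
move=> + leb; have [d] := ubnP (b - k); elim: d k => // d IHd k /ltnSE led Pk.
have [maxk|nmaxk] := classic (forall i, P i -> i <= k); first by exists k.
have [i Pi ltki] : exists2 i, P i & k < i.
  apply: NNPP => noex; apply: nmaxk => i Pi; rewrite leqNgt; apply/negP => ltki.
  by apply: noex; exists i.
apply: (IHd i _ Pi); apply: leq_trans led.
by rewrite ltn_sub2l // (leq_trans ltki) // leb.
Qed.

(** The total degree of any one generator bounds the exponents of the first
    variable, since raising this exponent by one lowers the remaining degree. *)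
Lemma sheds_max_degree (K : fieldType) n (J : subset_of K n.+1) u :
  sheds (mingens J) -> mingens J u -> exists r, max_degree ord0 J r.
Proof.
move=> shJ Gu.
pose b := u ord0 + \sum_(j < n.+1 | 0 < j) u j.
have [||r [z Gz <-] maxr] :=
  @bounded_nat_max (fun i => exists2 z, mingens J z & z ord0 = i) b (u ord0).
- by exists u.
- move=> _ [z Gz <-]; have [/leq_trans->|ltuz] := leqP (z ord0) (u ord0) => //.
    exact: leq_addr.
  have [||v [_ _ _ _ led]] :=
    sheds_jump (d := z ord0 - u ord0) (shJ ord0) Gu Gz.
  + by [].
  + by rewrite subnKC // ltnW.
  rewrite -leq_subLR; apply: leq_trans led; exact: leq_addr.
by exists (z ord0); split=> [|w Gw]; [exists z|apply: maxr; exists w].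
Qed.

Lemma monomial_ideal_eq0 (K : fieldType) n (J : subset_of K n) :
  monomial_ideal J -> ~ (exists u, mingens J u) -> eq_ideal J (ideal0 K n).
Proof.
move=> [M JM] noG p; rewrite (JM p) mon_idealP; split=> [suppM|->]; last first.
  by move=> m; rewrite msupp0.
apply/eqP; rewrite -msupp_eq0; case: (msupp p) suppM => // m s suppM.
have [//|u Mu _] := suppM m; first exact: mem_head.
have [|w Gw _] := @mingens_dvd K n J u; last by case: noG; exists w.
by apply/JM/mon_idealX; exists u; rewrite // lepm_refl.
Qed.

Lemma monomial_ideal_eq1 (K : fieldType) (J : subset_of K 0) u :
  monomial_ideal J -> mingens J u -> eq_ideal J (ideal1 K 0).
Proof.
move=> [M JM] [/JM/mon_idealX [w Mw _] _] p; split=> // _.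
apply/JM/mon_idealP => m _; exists w => //.
by apply/mnm_lepP; case.
Qed.

Lemma sheds_variable_decomposable (K : fieldType) n (J : subset_of K n) :
  monomial_ideal J -> sheds (mingens J) -> variable_decomposable J.
Proof.
elim: n J => [|n IHn] J monJ shJ;
  have [[u Gu]|noG] := classic (exists u, mingens J u).
- by right; apply: monomial_ideal_eq1 Gu.
- by left; apply: monomial_ideal_eq0.
- have [r maxr] := sheds_max_degree shJ Gu.
  right; exists ord0, r; split=> // i ir; last exact: sheds_extend ir.
  by apply: IHn; [apply: monomial_ideal_mon_ideal|apply: sheds_slice].
by left; left; apply: monomial_ideal_eq0.
Qed.

Theorem proposition4p35 (K : fieldType) (n : nat) (I J : subset_of K n) :
  pure_power_ideal I -> weakly_stable I J -> sequentially_pure J ->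
  variable_decomposable J.
Proof.
move=> ppI wsJ pureJ; apply: sheds_variable_decomposable.
  by case: wsJ.
exact: sheds_mingens ppI wsJ pureJ.
Qed.
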